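(* Let $A$ be an associative and commutative ring with unit, let $n\geq 6$ be an integer and let $\Gamma = EL_n(A)$. Suppose that: (1) $EL_2(A) = SL_2(A)$; (2) there is a constant $M\in\mathbb{N}$ such that every element of $\Gamma$ can be written as a product $x_1x_2\cdots x_M$ where each $x_m$ lies either in $G=SL_2(A)$ (embedded in $\Gamma$ as the upper-left $2\times 2$ block, i.e. $g\mapsto \begin{pmatrix} g & 0\\ 0 & I_{n-2}\end{pmatrix}$) or in the set of single commutators $\{aba^{-1}b^{-1} : a,b\in\Gamma\}$ of $\Gamma$. Then every quasi-homomorphism $\psi\colon\Gamma\to\mathbb{R}$ is bounded. Equivalently, the stable commutator length vanishes identically on $[\Gamma,\Gamma]$.
   Context: For an associative ring $B$ with unit, an elementary matrix in $M_n(B)$ is a matrix whose diagonal entries are $1$ and all of whose off-diagonal entries except at most one are $0$; $EL_n(B)$ is the group generated by all elementary matrices in $M_n(B)$. $SL_n(A)$ is the group of matrices in $M_n(A)$ of determinant $1$. A quasi-homomorphism on a group $\Gamma$ is a function $\psi\colon\Gamma\to\mathbb{R}$ with $\sup_{g,h\in\Gamma}|\psi(gh)-\psi(g)-\psi(h)|<\infty$. For $g\in[\Gamma,\Gamma]$, $\mathrm{cl}(g)$ is the least number of commutators whose product is $g$ ($\mathrm{cl}(e)=0$), and the stable commutator length is $\mathrm{scl}(g)=\lim_{k\to\infty}\mathrm{cl}(g^k)/k$. *)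

(* Defs.v *)
From Stdlib Require Import Reals.
From mathcomp Require Import all_boot all_algebra.
Set Implicit Arguments. Unset Strict Implicit. Unset Printing Implicit Defensive.
Import GRing.Theory.

Local Open Scope ring_scope.

Definition elementary (B : pzRingType) (n : nat) (M : 'M[B]_n) : Prop :=
  (forall i, M i i = 1) /\
  exists i0 j0 : 'I_n, forall k l : 'I_n, k != l -> (k, l) != (i0, j0) -> M k l = 0.

Inductive EL (B : pzRingType) (n : nat) : 'M[B]_n -> Prop :=
  | EL_gen M : elementary M -> EL M
  | EL_one : EL 1%:M
  | EL_mul M N : EL M -> EL N -> EL (M *m N)
  | EL_inv M N : EL M -> M *m N = 1%:M -> N *m M = 1%:M -> EL N.

Definition EL_commutator (B : pzRingType) (n : nat) (g : 'M[B]_n) : Prop :=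
  exists a b ai bi : 'M[B]_n,
    [/\ EL a, EL b, a *m ai = 1%:M /\ ai *m a = 1%:M,
        b *m bi = 1%:M /\ bi *m b = 1%:M & g = a *m b *m ai *m bi].

Definition embed2 (B : pzRingType) (n : nat) (g : 'M[B]_2) : 'M[B]_n :=
  \matrix_(i < n, j < n)
    if (nat_of_ord i < 2)%N && (nat_of_ord j < 2)%N then g (inord i) (inord j) else (i == j)%:R.

Definition mxprod (B : pzRingType) (n : nat) (xs : seq 'M[B]_n) : 'M[B]_n :=
  foldr (fun x y => x *m y) 1%:M xs.

Local Close Scope ring_scope.
Local Open Scope R_scope.

Definition quasi_hom (B : pzRingType) (n : nat) (psi : 'M[B]_n -> R) : Prop :=
  exists C : R, forall g h, EL g -> EL h ->
    Rabs (psi (mulmx g h) - psi g - psi h) <= C.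

Definition bounded_on_EL (B : pzRingType) (n : nat) (psi : 'M[B]_n -> R) : Prop :=
  exists C : R, forall g, EL g -> Rabs (psi g) <= C.

(* Main.v *)
Require Import Defs.
From Stdlib Require Import Reals Lra ClassicalEpsilon.
From mathcomp Require Import all_boot all_algebra ring.
Set Implicit Arguments. Unset Strict Implicit. Unset Printing Implicit Defensive.
Import GRing.Theory.

(* On SL_2(A), embedded through EL_3(A), a quasi-homomorphism depends up to a
   bounded error only on the first row (a, b), because elementary 3x3 matrices
   are single commutators.  The resulting function f(a, b) is a Mennicke symbol
   up to bounded errors: it changes boundedly under the elementary moves
   (a, b + a t) and (a + b t, b) and is almost multiplicative in each argument.
   Say that (a, b) is good if f(a, b^k) is bounded in k.  Comparing f(a^k, b^l)
   along both arguments shows that goodness is symmetric in a and b, so both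
   elementary moves preserve it; since EL_2(A) = SL_2(A), every unimodular row
   is good.  Almost multiplicativity then turns goodness into a bound on f that
   does not depend on the row, and bounded generation concludes. *)

Local Open Scope ring_scope.
Local Delimit Scope R_scope with re.

(** * Real numbers up to a bounded error *)

(** Two linear inequalities in place of an absolute value let [lra] add up errors directly. *)
Definition close (C x y : R) : Prop := (x <= y + C /\ y <= x + C)%re.

Lemma close_Rabs C x y : close C x y <-> (Rabs (x - y) <= C)%re.
Proof.
rewrite /close; split=> [h|]; first by apply: Rabs_le; lra.
by rewrite /Rabs; case: Rcase_abs; lra.
Qed.

Lemma close_trans C D x y z : close C x y -> close D y z -> close (C + D)%re x z.
Proof. by rewrite /close; lra. Qed.

(** If |x| exceeded [C], then k (|x| - C) would be unbounded in k, yet it stays below [C + K]. The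
    gain is that the conclusion no longer involves [K]. *)
Lemma close_linear_bounded (u : nat -> R) (x C K : R) :
  (forall k, close ((INR k + 1) * C) (u k) (INR k * x)) ->
  (forall k, close K (u k) 0) -> close C x 0.
Proof.
move=> hu hK.
have hk k : (INR k * (x - C) <= C + K /\ INR k * (- x - C) <= C + K)%re.
  by have [? ?] := hu k; have [? ?] := hK k; split; lra.
split; apply: Rnot_lt_le => hx.
  have [k] := INR_archimed (x - C) (C + K) ltac:(lra); have := hk k; lra.
have [k] := INR_archimed (- x - C) (C + K) ltac:(lra); have := hk k; lra.
Qed.

(** * Unimodular rows *)

Definition unimodular (A : comPzRingType) (a b : A) : Prop :=
  exists c d, a * d - b * c = 1.

Lemma unimodular_sym (A : comPzRingType) (a b : A) : unimodular a b -> unimodular b a.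
Proof. by move=> [c [d e]]; exists (- d), (- c); rewrite -e; ring. Qed.

Lemma unimodularMr (A : comPzRingType) (a b b' : A) :
  unimodular a b -> unimodular a b' -> unimodular a (b * b').
Proof.
(* Replacing b' c' by b' c' (a d - b c) in a d' - b' c' = 1 and collecting terms gives this second
   row, which is also the one in [Mennicke_identity]. *)
move=> [c [d e]] [c' [d' e']]; exists (- (c * c')), (d' - b' * c' * d).
transitivity (a * d' - b' * c' * (a * d - b * c)); first by ring.
by rewrite e mulr1.
Qed.

Lemma unimodularXr (A : comPzRingType) (a b : A) k : unimodular a b -> unimodular a (b ^+ k).
Proof.
move=> h; elim: k => [|k IHk]; last by rewrite exprS; apply: unimodularMr.
by exists (-1), 0; rewrite expr0; ring.
Qed.

Lemma unimodularXl (A : comPzRingType) (a b : A) k : unimodular a b -> unimodular (a ^+ k) b.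
Proof. by move/unimodular_sym/(unimodularXr k)/unimodular_sym. Qed.

Lemma unimodularDr (A : comPzRingType) (a b t : A) : unimodular a b -> unimodular a (b + a * t).
Proof. by move=> [c [d e]]; exists c, (d + t * c); rewrite -e; ring. Qed.

(** Congruence modulo [a] survives powers, so an elementary move on [b] becomes one on [b ^+ k].
    That [s] varies with [k] is harmless, since the error in [quasi_symbolDr] is the same for all
    multipliers. *)
Lemma exprD_mul_mod (A : comPzRingType) (a b t : A) k :
  exists s, (b + a * t) ^+ k = b ^+ k + a * s.
Proof.
elim: k => [|k [s IHk]]; first by exists 0; rewrite !expr0; ring.
exists (b * s + t * b ^+ k + t * a * s); rewrite !exprS IHk; ring.
Qed.

(** * Approximate Mennicke symbols and good rows *)

Record quasi_symbol (A : comPzRingType) (C : R) (f : A -> A -> R) : Prop := QuasiSymbol {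
  quasi_symbolMr : forall a b b', unimodular a b -> unimodular a b' ->
    close C (f a (b * b')) (f a b + f a b')%re;
  quasi_symbolMl : forall a a' b, unimodular a b -> unimodular a' b ->
    close C (f (a * a') b) (f a b + f a' b)%re;
  quasi_symbolDr : forall a b t, unimodular a b -> close C (f a (b + a * t)) (f a b);
  quasi_symbolDl : forall a b t, unimodular a b -> close C (f (a + b * t) b) (f a b) }.

Lemma quasi_symbol_swap (A : comPzRingType) (C : R) (f : A -> A -> R) :
  quasi_symbol C f -> quasi_symbol C (fun a b => f b a).
Proof.
move=> [hMr hMl hDr hDl]; split=> *.
- by apply: hMl; apply: unimodular_sym.
- by apply: hMr; apply: unimodular_sym.
- by apply: hDl; apply: unimodular_sym.
- by apply: hDr; apply: unimodular_sym.
Qed.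

Lemma quasi_symbolXr (A : comPzRingType) (C : R) (f : A -> A -> R) (a b : A) k :
  quasi_symbol C f -> unimodular a b ->
  close ((INR k + 1) * C) (f a (b ^+ k)) (INR k * f a b)%re.
Proof.
move=> hf um; elim: k => [|k].
  (* Since 1 * 1 = 1, the value [f a 1] is within [C] of 0; this is the extra [C] in
     [(INR k + 1) * C]. *)
  have um1 := unimodularXr 0 um; rewrite expr0 in um1 *.
  have := quasi_symbolMr hf um1 um1; rewrite mulr1 /close /=; lra.
have := quasi_symbolMr hf um (unimodularXr k um).
by rewrite -exprS S_INR /close; lra.
Qed.

(** This is goodness of a row. The bound [K] may depend on the row; [bounded_powers_close] removes
    that dependence. *)
Definition bounded_powers (A : comPzRingType) (f : A -> A -> R) (a b : A) : Prop :=
  exists K, forall k, close K (f a (b ^+ k)) 0.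

Lemma bounded_powers_close (A : comPzRingType) (C : R) (f : A -> A -> R) (a b : A) :
  quasi_symbol C f -> unimodular a b -> bounded_powers f a b -> close C (f a b) 0.
Proof.
move=> hf um [K hK]; apply: close_linear_bounded hK => k.
exact: quasi_symbolXr.
Qed.

(* The values f (a^k) (b^l) differ from k * f a (b^l) by an amount that depends
   on k only, so they stay bounded as l grows; hence the previous lemma bounds
   f (a^k) b uniformly in k. *)
Lemma bounded_powers_swap (A : comPzRingType) (C : R) (f : A -> A -> R) (a b : A) :
  quasi_symbol C f -> unimodular a b ->
  bounded_powers f a b -> bounded_powers (fun x y => f y x) b a.
Proof.
move=> hf um [K hK]; exists C => k.
apply: (bounded_powers_close hf (unimodularXl k um)).
exists ((INR k + 1) * C + INR k * K)%re => l.
have := quasi_symbolXr k (quasi_symbol_swap hf) (unimodular_sym (unimodularXr l um)).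
have [h1 h2] := hK l; have k0 := pos_INR k.
have := Rmult_le_compat_l _ _ _ k0 h1; have := Rmult_le_compat_l _ _ _ k0 h2.
by rewrite /close; lra.
Qed.

Lemma bounded_powersDr (A : comPzRingType) (C : R) (f : A -> A -> R) (a b t : A) :
  quasi_symbol C f -> unimodular a b ->
  bounded_powers f a b -> bounded_powers f a (b + a * t).
Proof.
move=> hf um [K hK]; exists (C + K)%re => k.
have [s ->] := exprD_mul_mod a b t k.
exact: close_trans (quasi_symbolDr hf s (unimodularXr k um)) (hK k).
Qed.

(** Adding a multiple of [b] to [a] is in general no elementary move on the row (a, b^k). So
    goodness is first carried over to the powers of [a], moved there, and carried back. *)
Lemma bounded_powersDl (A : comPzRingType) (C : R) (f : A -> A -> R) (a b t : A) :
  quasi_symbol C f -> unimodular a b ->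
  bounded_powers f a b -> bounded_powers f (a + b * t) b.
Proof.
move=> hf um /(bounded_powers_swap hf um) hz.
have hf' := quasi_symbol_swap hf; have um' := unimodular_sym um.
have := bounded_powersDr t hf' um' hz.
by apply: (bounded_powers_swap hf'); apply: unimodularDr.
Qed.

(** * Two-by-two matrices and the spread of goodness *)

Definition mx2 (A : comPzRingType) (a b c d : A) : 'M[A]_2 :=
  \matrix_(i, j) nth 0 (nth [::] [:: [:: a; b]; [:: c; d]] i) j.

Lemma ord2_cases (i : 'I_2) : i = ord0 \/ i = ord_max.
Proof. by case: i => [[|[|//]]] p; [left|right]; apply: val_inj. Qed.

Lemma mx2_eta (A : comPzRingType) (g : 'M[A]_2) :
  g = mx2 (g ord0 ord0) (g ord0 ord_max) (g ord_max ord0) (g ord_max ord_max).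
Proof.
by apply/matrixP=> i j; have [->|->] := ord2_cases i; have [->|->] := ord2_cases j;
  rewrite mxE.
Qed.

Lemma mulmx2 (A : comPzRingType) (a b c d a' b' c' d' : A) :
  mx2 a b c d *m mx2 a' b' c' d' =
  mx2 (a * a' + b * c') (a * b' + b * d') (c * a' + d * c') (c * b' + d * d').
Proof.
apply/matrixP=> i j; have [->|->] := ord2_cases i; have [->|->] := ord2_cases j;
  by rewrite !mxE !big_ord_recl big_ord0 !mxE /= addr0.
Qed.

Lemma det_mx2 (A : comPzRingType) (a b c d : A) : \det (mx2 a b c d) = a * d - b * c.
Proof.
by rewrite (expand_det_row _ ord0) !big_ord_recl big_ord0 /cofactor !det_mx11 !mxE /=; ring.
Qed.

Lemma elementary2_cases (A : comPzRingType) (M : 'M[A]_2) :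
  elementary M -> exists t, M = mx2 1 t 0 1 \/ M = mx2 1 0 t 1.
Proof.
move=> [h1 [i0 [j0 h0]]].
case: (eqVneq (ord0, ord_max) (i0, j0)) => [e|ne].
  exists (M ord0 ord_max); left; rewrite [LHS]mx2_eta !h1.
  by rewrite (h0 ord_max ord0) // -e.
by exists (M ord_max ord0); right; rewrite [LHS]mx2_eta !h1 (h0 ord0 ord_max).
Qed.

(** Right multiplication by an elementary matrix performs one of the two moves on the first row, so
    goodness spreads from the row (1, 0) of the identity to the first row of any product of
    elementary matrices. *)
Lemma quasi_symbol_close0 (A : comPzRingType) (C : R) (f : A -> A -> R) (a b : A) :
  (forall g : 'M[A]_2, EL g <-> \det g = 1) ->
  quasi_symbol C f -> unimodular a b -> close C (f a b) 0.
Proof.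
move=> h1 hf um.
pose Z (g : 'M[A]_2) := bounded_powers f (g ord0 ord0) (g ord0 ord_max).
have um_row (g : 'M[A]_2) : \det g = 1 -> unimodular (g ord0 ord0) (g ord0 ord_max).
  by rewrite [g]mx2_eta det_mx2 !mxE /=; do 2 eexists; eauto.
(* An equivalence for all [g] makes the induction pass through inverses: there the hypothesis on [M]
   is used at [g *m N]. *)
have ZM (h : 'M[A]_2) : EL h -> forall g, \det g = 1 -> Z g <-> Z (g *m h).
  elim=> {h} [M /elementary2_cases[t e]|||].
  - have hM : \det M = 1 by case: e => ->; rewrite det_mx2; ring.
    have step (s : A) N (g : 'M[A]_2) : N = mx2 1 s 0 1 \/ N = mx2 1 0 s 1 ->
        \det g = 1 -> Z g -> Z (g *m N).
      move=> eN /um_row; rewrite /Z [g]mx2_eta.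
      case: eN => ->; rewrite mulmx2 !mxE /= !(mulr0, mulr1, addr0, add0r) => hu.
        by rewrite addrC; apply: bounded_powersDr hf hu.
      exact: bounded_powersDl hf hu.
    move=> g hg; split; first exact: step e hg.
    have [N [eN eMN]] : exists N, (N = mx2 1 (- t) 0 1 \/ N = mx2 1 0 (- t) 1) /\ M *m N = 1%:M.
      case: e => ->; [exists (mx2 1 (- t) 0 1)|exists (mx2 1 0 (- t) 1)];
        (split; first by auto); rewrite mulmx2 [RHS]mx2_eta !mxE /=; congr mx2; ring.
    rewrite -{2}[g]mulmx1 -eMN mulmxA; apply: step eN _.
    by rewrite det_mulmx hg hM mulr1.
  - by move=> g _; rewrite mulmx1.
  - move=> M N hM IM _ IN g hg; rewrite mulmxA -IN; first exact: IM.
    by rewrite det_mulmx hg mul1r; apply/h1.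
  - move=> M N hM IM MN NM g hg.
    rewrite (IM (g *m N)); first by rewrite -mulmxA NM mulmx1.
    by rewrite det_mulmx hg mul1r; apply/h1; apply: EL_inv MN NM.
have [c [d e]] := um.
have hg : \det (mx2 a b c d) = 1 by rewrite det_mx2.
apply: (bounded_powers_close hf um).
have : Z (mx2 a b c d).
  rewrite -[mx2 _ _ _ _]mul1mx -ZM ?det1 //; last by apply/h1.
  (* The values to bound are f(1, 0^k), where 0^0 = 1. Adding 1 * 0^k to the second entry of (1, 0)
     costs at most [C] for every k. *)
  exists (C + Rabs (f 1%R 0%R))%re => k; rewrite !mxE /=.
  have := quasi_symbolDr (a := 1) (b := 0) hf (0 ^+ k).
  rewrite add0r mul1r => hk; apply: close_trans (hk _) _.
    by exists 0, 1; ring.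
  by apply/close_Rabs; rewrite Rminus_0_r; lra.
by rewrite /Z !mxE.
Qed.

(** * Quasi-homomorphisms with an explicit defect *)

Definition quasi_hom_defect (B : pzRingType) (n : nat) (D : R) (psi : 'M[B]_n -> R) : Prop :=
  forall g h, EL g -> EL h -> close D (psi (g *m h)) (psi g + psi h)%re.

Lemma quasi_hom_inv (B : pzRingType) (n : nat) (D : R) (psi : 'M[B]_n -> R) g g' :
  quasi_hom_defect D psi -> EL g -> EL g' -> g *m g' = 1%:M ->
  close (2 * D) (psi g + psi g')%re 0.
Proof.
move=> hpsi eg eg' e.
have := hpsi _ _ eg eg'; have := hpsi _ _ (EL_one B n) (EL_one B n).
by rewrite e mul1mx /close; lra.
Qed.

Lemma quasi_hom_conj (B : pzRingType) (n : nat) (D : R) (psi : 'M[B]_n -> R) q g q' :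
  quasi_hom_defect D psi -> EL q -> EL g -> EL q' -> q *m q' = 1%:M ->
  close (4 * D) (psi (q *m g *m q')) (psi g).
Proof.
move=> hpsi eq eg eq' e.
have := quasi_hom_inv hpsi eq eq' e.
have := hpsi _ _ (EL_mul eq eg) eq'; have := hpsi _ _ eq eg.
by rewrite /close; lra.
Qed.

(** Membership is bundled with the bound because the defect inequality speaks only of elements of
    [EL]. *)
Definition EL_small (B : pzRingType) (n : nat) (psi : 'M[B]_n -> R) (C : R) (g : 'M[B]_n) : Prop :=
  EL g /\ close C (psi g) 0.

Lemma EL_smallM (B : pzRingType) (n : nat) (D C C' : R) (psi : 'M[B]_n -> R) g h :
  quasi_hom_defect D psi -> EL_small psi C g -> EL_small psi C' h ->
  EL_small psi (C + C' + D) (g *m h).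
Proof.
move=> hpsi [eg hg] [eh hh]; split; first exact: EL_mul.
by have := hpsi _ _ eg eh; rewrite /close in hg hh *; lra.
Qed.

Lemma quasi_hom_sandwich (B : pzRingType) (n : nat) (D C C' : R) (psi : 'M[B]_n -> R) l x y r :
  quasi_hom_defect D psi -> EL_small psi C l -> EL x -> EL y -> EL_small psi C' r ->
  close (C + C' + 3 * D) (psi (l *m x *m y *m r)) (psi x + psi y)%re.
Proof.
move=> hpsi [el hl] ex ey [er hr]; have elx := EL_mul el ex; have elxy := EL_mul elx ey.
have := hpsi _ _ el ex; have := hpsi _ _ elx ey; have := hpsi _ _ elxy er.
by rewrite /close in hl hr *; lra.
Qed.

(** The three products cost 3D, and each of the two pairs of inverse factors cancels up to 2D. *)
Lemma commutator_small (B : pzRingType) (n : nat) (D : R) (psi : 'M[B]_n -> R) g :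
  quasi_hom_defect D psi -> EL_commutator g -> EL_small psi (7 * D) g.
Proof.
move=> hpsi [a [b [a' [b' [ea eb [aa' a'a] [bb' b'b] ->]]]]].
have ea' := EL_inv ea aa' a'a; have eb' := EL_inv eb bb' b'b.
have eab := EL_mul ea eb; have eaba := EL_mul eab ea'.
split; first exact: EL_mul.
have := quasi_hom_inv hpsi ea ea' aa'; have := quasi_hom_inv hpsi eb eb' bb'.
have := hpsi _ _ ea eb; have := hpsi _ _ eab ea'; have := hpsi _ _ eaba eb'.
by rewrite /close; lra.
Qed.

(** * Transvections as commutators *)

Definition transvection (B : pzRingType) (n : nat) (i j : 'I_n) (t : B) : 'M[B]_n :=
  1%:M + t *: delta_mx i j.

Lemma EL_transvection (B : pzRingType) (n : nat) (i j : 'I_n) (t : B) :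
  i != j -> EL (transvection i j t).
Proof.
move=> ij; apply: EL_gen; split=> [k|].
  rewrite !mxE eqxx; case: (eqVneq k i) => [->|_] /=; last by rewrite mulr0 addr0.
  by rewrite (negbTE ij) mulr0 addr0.
exists i, j => k l kl nkl; rewrite !mxE (negbTE kl) add0r.
by rewrite -xpair_eqE (negbTE nkl) mulr0.
Qed.

Lemma transvectionD (A : comPzRingType) (n : nat) (i j : 'I_n) (s t : A) :
  i != j -> transvection i j s *m transvection i j t = transvection i j (s + t).
Proof.
move=> ij; rewrite /transvection mulmxDl mul1mx mulmxDr mulmx1 -scalemxAl -scalemxAr.
by rewrite mul_delta_mx_0 1?eq_sym // !scaler0 addr0 scalerDl addrAC -addrA.
Qed.

(** Steinberg's relation [e_ik(t), e_kj(1)] = e_ij(t). The third index [k] is the reason for working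
    in size 3 rather than 2. *)
Lemma transvection_commutator (A : comPzRingType) (n : nat) (i j k : 'I_n) (t : A) :
  i != j -> i != k -> k != j -> EL_commutator (transvection i j t).
Proof.
move=> ij ik kj.
exists (transvection i k t), (transvection k j 1), (transvection i k (- t)),
  (transvection k j (- 1)).
have t0 (x y : 'I_n) : transvection x y (0 : A) = 1%:M.
  by rewrite /transvection scale0r addr0.
split; try exact: EL_transvection.
- by rewrite !transvectionD // subrr addNr t0.
- by rewrite !transvectionD // subrr addNr t0.
rewrite /transvection !(mulmxDl, mulmxDr, mul1mx, mulmx1) -!(scalemxAl, scalemxAr).
have [ji jk ki] : [/\ j != i, j != k & k != i] by split; rewrite eq_sym.
rewrite !mul_delta_mx !mul_delta_mx_0 // !(mul0mx, scaler0).
by apply/matrixP=> x y; rewrite !mxE; ring.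
Qed.

Lemma transvection3_small (A : comPzRingType) (D : R) (psi : 'M[A]_3 -> R) i j t :
  quasi_hom_defect D psi -> i != j -> EL_small psi (7 * D) (transvection i j t).
Proof.
move=> hpsi ij; apply: commutator_small => //.
have /existsP[k /andP[ik kj]] : [exists k, (i != k) && (k != j)].
  have: [forall i : 'I_3, forall j : 'I_3, exists k, (i != k) && (k != j)].
    apply/forallP=> x; apply/forallP=> y; apply/existsP.
    case: x y => [[|[|[|//]]] ?] [[|[|[|//]]] ?];
      by [exists (inord 0); rewrite -!val_eqE /= !inordK
         |exists (inord 1); rewrite -!val_eqE /= !inordK
         |exists (inord 2); rewrite -!val_eqE /= !inordK].
  by move/forallP/(_ i)/forallP/(_ j).
exact: transvection_commutator ij ik kj.
Qed.

(** * Explicit three-by-three matrices and the Mennicke identity *)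

Definition mx3 (A : comPzRingType) (a b c d e f g h k : A) : 'M[A]_3 :=
  \matrix_(i, j) nth 0 (nth [::] [:: [:: a; b; c]; [:: d; e; f]; [:: g; h; k]] i) j.

Lemma ord3_cases (i : 'I_3) : [\/ i = inord 0, i = inord 1 | i = inord 2].
Proof.
by case: i => [[|[|[|//]]] p]; [constructor 1|constructor 2|constructor 3];
  apply: val_inj; rewrite /= inordK.
Qed.

Lemma mx3P (A : comPzRingType) (M N : 'M[A]_3) :
  (forall i j, (i < 3)%N -> (j < 3)%N -> M (inord i) (inord j) = N (inord i) (inord j)) -> M = N.
Proof.
move=> h; apply/matrixP=> i j.
by have [->|->|->] := ord3_cases i; have [->|->|->] := ord3_cases j; apply: h.
Qed.

Lemma mulmx3 (A : comPzRingType) (a b c d e f g h k a' b' c' d' e' f' g' h' k' : A) :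
  mx3 a b c d e f g h k *m mx3 a' b' c' d' e' f' g' h' k' =
  mx3 (a * a' + b * d' + c * g') (a * b' + b * e' + c * h') (a * c' + b * f' + c * k')
      (d * a' + e * d' + f * g') (d * b' + e * e' + f * h') (d * c' + e * f' + f * k')
      (g * a' + h * d' + k * g') (g * b' + h * e' + k * h') (g * c' + h * f' + k * k').
Proof.
apply/mx3P=> - [|[|[|//]]] [|[|[|//]]] _ _;
  by rewrite !mxE !big_ord_recl big_ord0 !mxE /= !inordK //= addr0 addrA.
Qed.

Lemma embed2_mx3 (A : comPzRingType) (a b c d : A) :
  embed2 3 (mx2 a b c d) = mx3 a b 0 c d 0 0 0 1.
Proof.
have val3 k : (k < 3)%N -> nat_of_ord (inord k : 'I_3) = k by exact: inordK.
apply/mx3P=> - [|[|[|//]]] [|[|[|//]]] _ _;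
  by rewrite !mxE -?val_eqE /= !val3 //= ?mxE /= ?inordK.
Qed.

Lemma transvection_mx3 (A : comPzRingType) (t : A) :
  [/\ transvection (inord 0 : 'I_3) (inord 1) t = mx3 1 t 0 0 1 0 0 0 1,
      transvection (inord 0 : 'I_3) (inord 2) t = mx3 1 0 t 0 1 0 0 0 1 &
      transvection (inord 1 : 'I_3) (inord 0) t = mx3 1 0 0 t 1 0 0 0 1] /\
  [/\ transvection (inord 1 : 'I_3) (inord 2) t = mx3 1 0 0 0 1 t 0 0 1,
      transvection (inord 2 : 'I_3) (inord 0) t = mx3 1 0 0 0 1 0 t 0 1 &
      transvection (inord 2 : 'I_3) (inord 1) t = mx3 1 0 0 0 1 0 0 t 1].
Proof.
by do 2 split; apply/mx3P=> - [|[|[|//]]] [|[|[|//]]] _ _;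
  rewrite !mxE -!val_eqE /= !inordK //= ?(mulr1, mulr0, addr0, add0r).
Qed.

Lemma mx3_transvection_small (A : comPzRingType) (D : R) (psi : 'M[A]_3 -> R) t :
  quasi_hom_defect D psi ->
  [/\ EL_small psi (7 * D) (mx3 1 t 0 0 1 0 0 0 1),
      EL_small psi (7 * D) (mx3 1 0 t 0 1 0 0 0 1) &
      EL_small psi (7 * D) (mx3 1 0 0 t 1 0 0 0 1)] /\
  [/\ EL_small psi (7 * D) (mx3 1 0 0 0 1 t 0 0 1),
      EL_small psi (7 * D) (mx3 1 0 0 0 1 0 t 0 1) &
      EL_small psi (7 * D) (mx3 1 0 0 0 1 0 0 t 1)].
Proof.
move=> hpsi; have [[<- <- <-] [<- <- <-]] := transvection_mx3 t.
by do 2 split; apply: transvection3_small => //; rewrite -val_eqE /= !inordK.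
Qed.

(* A product of block matrices whose first row is (a, b * b', 0) reduces, using
   the unit entry a * d - b * c = 1, to a block matrix with first row
   (a, b * b'): this is the multiplicativity of Mennicke symbols. *)
Lemma Mennicke_identity (A : comPzRingType) (a b c d b' c' d' : A) :
  a * d - b * c = 1 -> a * d' - b' * c' = 1 ->
  mx3 a (b * b') 0 (- (c * c')) (d' - b' * c' * d) 0 0 0 1 =
  mx3 1 0 0 0 0 1 0 (-1) 0 *m mx3 1 0 0 0 1 0 0 (- c') 1 *m mx3 a b 0 c d 0 0 0 1
  *m mx3 1 0 0 0 a b' 0 c' d'
  *m (mx3 1 0 0 0 0 (-1) 0 1 0 *m mx3 1 0 b 0 1 0 0 0 1
      *m mx3 1 0 0 0 1 0 c 0 1 *m mx3 1 0 0 0 1 0 0 (d * b') 1).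
Proof.
move=> e e'; have {}e : a * d = 1 + b * c by rewrite -e; ring.
have {}e' : a * d' = 1 + b' * c' by rewrite -e'; ring.
by rewrite !mulmx3; congr mx3; ring: e e'.
Qed.

(** * Corner embeddings *)

(** The embedding of 2x2 matrices factors through every corner of size p >= 2: p = 2 yields
    membership in [EL], and p = 3 gives the passage to EL_3. *)
Lemma embed2_block (A : pzRingType) (p q : nat) (g : 'M[A]_2) :
  (2 <= p)%N -> embed2 (p + q) g = block_mx (embed2 p g) 0 0 1%:M.
Proof.
move=> hp; have rF (k : 'I_q) : (rshift p k < 2)%N = false.
  by apply/negbTE; rewrite -leqNgt (leq_trans hp) // leq_addr.
apply/matrixP=> i j; rewrite -[i]splitK -[j]splitK.
case: (split i) => k; case: (split j) => l;
  rewrite ?block_mxEul ?block_mxEur ?block_mxEdl ?block_mxEdr !mxE ?rF ?andbF //=.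
- by rewrite eq_lrshift.
- by rewrite eq_rlshift.
- by rewrite eq_rshift.
Qed.

Lemma embed2_2 (A : pzRingType) (g : 'M[A]_2) : embed2 2 g = g.
Proof. by apply/matrixP=> i j; rewrite mxE !ltn_ord /= !inord_val. Qed.

Lemma mulmx_corner (A : pzRingType) (p q : nat) (M N : 'M[A]_p) :
  block_mx (M *m N) 0 0 1%:M =
  block_mx M 0 0 1%:M *m block_mx N 0 0 1%:M :> 'M_(p + q).
Proof. by rewrite mulmx_block !mulmx0 !mul0mx !addr0 mulmx1 add0r. Qed.

Lemma EL_corner (A : pzRingType) (p q : nat) (M : 'M[A]_p) :
  EL M -> EL (block_mx M 0 0 1%:M : 'M_(p + q)).
Proof.
elim=> {M} [M [h1 [i0 [j0 h0]]]||M N _ IM _ IN|M N _ IM MN NM].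
- apply: EL_gen; split=> [i|].
    by case: (split_ordP i) => k ->; rewrite ?block_mxEul ?block_mxEdr ?mxE ?eqxx.
  exists (lshift q i0), (lshift q j0) => i j.
  case: (split_ordP i) => k ->; case: (split_ordP j) => l ->;
    rewrite ?block_mxEul ?block_mxEur ?block_mxEdl ?block_mxEdr ?mxE //.
    by rewrite xpair_eqE !eq_lshift -xpair_eqE => kl; apply: h0.
  by rewrite eq_rshift => /negbTE->.
- by rewrite -scalar_mx_block; apply: EL_one.
- by rewrite mulmx_corner; apply: EL_mul.
- by apply: EL_inv IM _ _; rewrite -mulmx_corner ?MN ?NM -scalar_mx_block.
Qed.

Lemma EL_embed2 (A : pzRingType) (m : nat) (g : 'M[A]_2) : EL g -> EL (embed2 (2 + m) g).
Proof. by rewrite embed2_block // embed2_2; apply: EL_corner. Qed.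

(** * The first-row function is an approximate Mennicke symbol *)

Lemma EL_embed2_3 (A : comPzRingType) (a b c d : A) :
  (forall g : 'M[A]_2, EL g <-> \det g = 1) -> a * d - b * c = 1 ->
  EL (mx3 a b 0 c d 0 0 0 1).
Proof. by move=> h1 e; rewrite -embed2_mx3; apply: (@EL_embed2 A 1); rewrite h1 det_mx2. Qed.

(* The completion (c, d) of the row (a, b) is arbitrary, and junk when (a, b) is
   not unimodular. *)
Definition row_value (A : comPzRingType) (psi : 'M[A]_3 -> R) (a b : A) : R :=
  let p := epsilon (inhabits (0, 0)) (fun p => a * p.2 - b * p.1 = 1) in
  psi (mx3 a b 0 p.1 p.2 0 0 0 1).

(** Two completions of a row to determinant 1 differ by a left factor e_21(c d' - d c'). It is small
    up to 7D and the product costs D; hence the choice made in [row_value] does not matter. *)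
Lemma close_row_value (A : comPzRingType) (D : R) (psi : 'M[A]_3 -> R) (a b c d : A) :
  (forall g : 'M[A]_2, EL g <-> \det g = 1) -> quasi_hom_defect D psi ->
  a * d - b * c = 1 -> close (8 * D) (psi (mx3 a b 0 c d 0 0 0 1)) (row_value psi a b).
Proof.
move=> h1 hpsi e; rewrite /row_value.
have := epsilon_spec (inhabits (0, 0)) (fun p => a * p.2 - b * p.1 = 1)
  (ex_intro _ (c, d) e).
case: (epsilon _ _) => c' d' /= e'.
have eE : mx3 a b 0 c d 0 0 0 1 =
    mx3 1 0 0 (c * d' - d * c') 1 0 0 0 1 *m mx3 a b 0 c' d' 0 0 0 1.
  rewrite mulmx3; congr mx3; try by ring.
    transitivity (c * (a * d' - b * c') + c' - c' * (a * d - b * c)); last by ring.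
    by rewrite e e'; ring.
  transitivity (d * (a * d' - b * c') + d' - d' * (a * d - b * c)); last by ring.
  by rewrite e e'; ring.
have [[_ _ [eg hg]] _] := mx3_transvection_small (c * d' - d * c') hpsi.
have := hpsi _ _ eg (EL_embed2_3 h1 e').
by rewrite -eE /close in hg *; lra.
Qed.

(** Each signed transposition is e_ij(s) e_ji(-s) e_ij(s) with s = 1 or s = -1: three transvections
    at 7D and two products at D. *)
Lemma mx3_swap_small (A : comPzRingType) (D : R) (psi : 'M[A]_3 -> R) :
  quasi_hom_defect D psi ->
  [/\ EL_small psi (23 * D) (mx3 1 0 0 0 0 1 0 (-1) 0),
      EL_small psi (23 * D) (mx3 1 0 0 0 0 (-1) 0 1 0) &
      EL_small psi (23 * D) (mx3 0 (-1) 0 1 0 0 0 0 1)].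
Proof.
move=> hpsi; have -> : (23 * D = 7 * D + 7 * D + D + 7 * D + D)%re by lra.
have [[h12 _ h21] [h23 _ h32]] := mx3_transvection_small 1 hpsi.
have [[h12' _ h21'] [h23' _ h32']] := mx3_transvection_small (-1) hpsi.
split.
- have := EL_smallM hpsi (EL_smallM hpsi h23 h32') h23.
  by rewrite !mulmx3; congr (EL_small _ _ (mx3 _ _ _ _ _ _ _ _ _)); ring.
- have := EL_smallM hpsi (EL_smallM hpsi h23' h32) h23'.
  by rewrite !mulmx3; congr (EL_small _ _ (mx3 _ _ _ _ _ _ _ _ _)); ring.
- have := EL_smallM hpsi (EL_smallM hpsi h12' h21) h12'.
  by rewrite !mulmx3; congr (EL_small _ _ (mx3 _ _ _ _ _ _ _ _ _)); ring.
Qed.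

Lemma close_lower_block (A : comPzRingType) (D : R) (psi : 'M[A]_3 -> R) (a b c d : A) :
  (forall g : 'M[A]_2, EL g <-> \det g = 1) -> quasi_hom_defect D psi ->
  a * d - b * c = 1 ->
  EL (mx3 1 0 0 0 a b 0 c d) /\
  close (4 * D) (psi (mx3 1 0 0 0 a b 0 c d)) (psi (mx3 a b 0 c d 0 0 0 1)).
Proof.
move=> h1 hpsi e; have eg := EL_embed2_3 h1 e.
have [[e1 _] [e2 _] [e3 _]] := mx3_swap_small hpsi.
have e4 := EL_embed2_3 (a := 0) (b := 1) (c := -1) (d := 0) h1 ltac:(ring).
(* The signs cancel: [q] is the permutation matrix of a 3-cycle, and conjugation by it shifts the
   upper-left block to the lower-right corner. *)
pose q := mx3 0 (-1) 0 1 0 0 0 0 1 *m mx3 1 0 0 0 0 (-1) 0 1 0 : 'M[A]_3.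
pose q' := mx3 1 0 0 0 0 1 0 (-1) 0 *m mx3 0 1 0 (-1) 0 0 0 0 1 : 'M[A]_3.
have eq : EL q by apply: EL_mul.
have eq' : EL q' by apply: EL_mul.
have qq' : q *m q' = 1%:M.
  have -> : 1%:M = mx3 1 0 0 0 1 0 0 0 1 :> 'M[A]_3.
    by have [[<- _ _] _] := transvection_mx3 (0 : A); rewrite /transvection scale0r addr0.
  by rewrite /q /q' !mulmx3; congr mx3; ring.
have -> : mx3 1 0 0 0 a b 0 c d = q *m mx3 a b 0 c d 0 0 0 1 *m q'.
  by rewrite /q /q' !mulmx3; congr mx3; ring.
by split; [do !apply: EL_mul|apply: quasi_hom_conj].
Qed.

Lemma row_valueMr (A : comPzRingType) (D : R) (psi : 'M[A]_3 -> R) (a b b' : A) :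
  (forall g : 'M[A]_2, EL g <-> \det g = 1) -> quasi_hom_defect D psi ->
  unimodular a b -> unimodular a b' ->
  close (109 * D) (row_value psi a (b * b')) (row_value psi a b + row_value psi a b')%re.
Proof.
move=> h1 hpsi [c [d e]] [c' [d' e']].
have := Mennicke_identity e e'.
move ec: (- (c * c')) => c''; move ed: (d' - b' * c' * d) => d'' eM.
have e'' : a * d'' - b * b' * c'' = 1.
  rewrite -ec -ed; transitivity (a * d' - b' * c' * (a * d - b * c)); first by ring.
  by rewrite e mulr1.
have := close_row_value h1 hpsi e''.
have := close_row_value h1 hpsi e'; have := close_row_value h1 hpsi e.
have [p1 p2 _] := mx3_swap_small hpsi.
have [[_ _ _] [_ _ p3]] := mx3_transvection_small (- c') hpsi.
have [[_ p4 _] _] := mx3_transvection_small b hpsi.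
have [_ [_ p5 _]] := mx3_transvection_small c hpsi.
have [_ [_ _ p6]] := mx3_transvection_small (d * b') hpsi.
have ex := EL_embed2_3 h1 e; have [ey hy] := close_lower_block h1 hpsi e'.
(* The left factors of [Mennicke_identity] cost 31D, the right ones 47D, and the sandwich 3D. Moving
   the lower block adds 4D and three changes of completion add 24D, in total 109D. *)
have := quasi_hom_sandwich hpsi (EL_smallM hpsi p1 p3) ex ey
  (EL_smallM hpsi (EL_smallM hpsi (EL_smallM hpsi p2 p4) p5) p6).
rewrite -eM.
by rewrite /close in hy *; lra.
Qed.

Lemma row_valueDr (A : comPzRingType) (D : R) (psi : 'M[A]_3 -> R) (a b t : A) :
  (forall g : 'M[A]_2, EL g <-> \det g = 1) -> quasi_hom_defect D psi -> unimodular a b ->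
  close (24 * D) (row_value psi a (b + a * t)) (row_value psi a b).
Proof.
move=> h1 hpsi [c [d e]].
move eb: (b + a * t) => b1; move ed: (d + c * t) => d1.
have e' : a * d1 - b1 * c = 1 by rewrite -eb -ed -e; ring.
have := close_row_value h1 hpsi e'; have := close_row_value h1 hpsi e.
have eM : mx3 a b1 0 c d1 0 0 0 1 =
    mx3 a b 0 c d 0 0 0 1 *m mx3 1 t 0 0 1 0 0 0 1.
  by rewrite mulmx3 -eb -ed; congr mx3; ring.
have [[[et ht] _ _] _] := mx3_transvection_small t hpsi.
by have := hpsi _ _ (EL_embed2_3 h1 e) et; rewrite -eM /close in ht *; lra.
Qed.

Lemma row_valueDl (A : comPzRingType) (D : R) (psi : 'M[A]_3 -> R) (a b t : A) :
  (forall g : 'M[A]_2, EL g <-> \det g = 1) -> quasi_hom_defect D psi -> unimodular a b ->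
  close (24 * D) (row_value psi (a + b * t) b) (row_value psi a b).
Proof.
move=> h1 hpsi [c [d e]].
move ea: (a + b * t) => a1; move ec: (c + d * t) => c1.
have e' : a1 * d - b * c1 = 1 by rewrite -ea -ec -e; ring.
have := close_row_value h1 hpsi e'; have := close_row_value h1 hpsi e.
have eM : mx3 a1 b 0 c1 d 0 0 0 1 =
    mx3 a b 0 c d 0 0 0 1 *m mx3 1 0 0 t 1 0 0 0 1.
  by rewrite mulmx3 -ea -ec; congr mx3; ring.
have [[_ _ [et ht]] _] := mx3_transvection_small t hpsi.
by have := hpsi _ _ (EL_embed2_3 h1 e) et; rewrite -eM /close in ht *; lra.
Qed.

(** Right multiplication by a signed transposition exchanges the two columns up to sign. This is the
    source of the symmetry of the row function. *)
Lemma row_value_rot (A : comPzRingType) (D : R) (psi : 'M[A]_3 -> R) (a b : A) :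
  (forall g : 'M[A]_2, EL g <-> \det g = 1) -> quasi_hom_defect D psi -> unimodular a b ->
  close (40 * D) (row_value psi b (- a)) (row_value psi a b).
Proof.
move=> h1 hpsi [c [d e]].
have e' : b * (- c) - (- a) * d = 1 by rewrite -e; ring.
have := close_row_value h1 hpsi e'; have := close_row_value h1 hpsi e.
have eM : mx3 b (- a) 0 d (- c) 0 0 0 1 =
    mx3 a b 0 c d 0 0 0 1 *m mx3 0 (-1) 0 1 0 0 0 0 1.
  by rewrite mulmx3; congr mx3; ring.
have [_ _ [et ht]] := mx3_swap_small hpsi.
by have := hpsi _ _ (EL_embed2_3 h1 e) et; rewrite -eM /close in ht *; lra.
Qed.

(** Multiplicativity in the first argument is deduced from that in the second through approximate
    symmetry. Rotation gives f(b, -a), and the sign splits off as f(b, -1), which is bounded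
    uniformly in b. *)
Lemma quasi_symbol_row_value (A : comPzRingType) (D : R) (psi : 'M[A]_3 -> R) :
  (forall g : 'M[A]_2, EL g <-> \det g = 1) -> quasi_hom_defect D psi ->
  quasi_symbol (628 * D + 3 * Rabs (row_value psi 0%R (-1)%R)) (row_value psi).
Proof.
move=> h1 hpsi; set f := row_value psi; set c0 := Rabs _.
have D0 : (0 <= D)%re by have := hpsi _ _ (EL_one A 3) (EL_one A 3); rewrite /close; lra.
have hc0 : close c0 (f 0 (-1)) 0 by apply/close_Rabs; rewrite Rminus_0_r; apply: Rle_refl.
have c00 : (0 <= c0)%re by apply: Rabs_pos.
have um1 (b : A) : unimodular b (-1) by exists 1, 0; ring.
have f1 b : close (24 * D + c0) (f b (-1)) 0.
  (* Adding b times the entry -1 turns (b, -1) into (0, -1), whose value is a single constant. *)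
  have hb : close (24 * D) (f 0 (-1)) (f b (-1)).
    by have := row_valueDl b h1 hpsi (um1 b); rewrite mulN1r subrr.
  by rewrite /close in hc0 hb *; lra.
have fN b x : unimodular b x -> close (109 * D) (f b (- x)) (f b (-1)%R + f b x)%re.
  by move=> um; rewrite -[- x]mulN1r; exact: row_valueMr h1 hpsi (um1 b) um.
have fS a b : unimodular a b -> close (173 * D + c0) (f a b) (f b a).
  move=> um; have := row_value_rot h1 hpsi um; have := fN _ _ (unimodular_sym um).
  by have := f1 b; rewrite -/f /close; lra.
split.
- by move=> a b b' um um'; have := row_valueMr h1 hpsi um um'; rewrite -/f /close; lra.
- move=> a a' b um um'; have umS := unimodular_sym um; have umS' := unimodular_sym um'.
  have hS : close (173 * D + c0) (f (a * a') b) (f b (a * a')).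
    by apply/fS/unimodular_sym/unimodularMr.
  have hM : close (109 * D) (f b (a * a')) (f b a + f b a')%re by exact: row_valueMr h1 hpsi umS umS'.
  have := fS _ _ um; have := fS _ _ um'.
  by rewrite /close in hS hM *; lra.
- by move=> a b t um; have := row_valueDr t h1 hpsi um; rewrite -/f /close; lra.
- by move=> a b t um; have := row_valueDl t h1 hpsi um; rewrite -/f /close; lra.
Qed.

Lemma quasi_hom_defect_corner (A : comPzRingType) (p q : nat) (D : R)
  (psi : 'M[A]_(p + q) -> R) :
  quasi_hom_defect D psi ->
  quasi_hom_defect D (fun g : 'M_p => psi (block_mx g 0 0 1%:M)).
Proof. by move=> hpsi g h eg eh; rewrite mulmx_corner; apply: hpsi; apply: EL_corner. Qed.

Lemma quasi_hom_embed2_bounded (A : comPzRingType) (m : nat) (D : R)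
  (psi : 'M[A]_(3 + m) -> R) :
  (forall g : 'M[A]_2, EL g <-> \det g = 1) -> quasi_hom_defect D psi ->
  exists C, forall s : 'M[A]_2, \det s = 1 -> EL_small psi C (embed2 (3 + m) s).
Proof.
move=> h1 hpsi; have hpsi3 := quasi_hom_defect_corner hpsi.
have hf := quasi_symbol_row_value h1 hpsi3.
eexists => s; rewrite -h1 => es; split; first exact: (@EL_embed2 A m.+1).
rewrite embed2_block //.
move: es; rewrite h1 [s]mx2_eta det_mx2 embed2_mx3.
move: (s _ _) (s _ _) (s _ _) (s _ _) => c b d a e.
have um : unimodular a b by exists c, d.
exact: close_trans (close_row_value h1 hpsi3 e) (quasi_symbol_close0 h1 hf um).
Qed.

Lemma mxprod_small (B : pzRingType) (n : nat) (D C : R) (psi : 'M[B]_n -> R)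
  (xs : seq 'M[B]_n) :
  quasi_hom_defect D psi -> (forall x, List.In x xs -> EL_small psi C x) ->
  EL_small psi (D + INR (size xs) * (C + D)) (mxprod xs).
Proof.
move=> hpsi; elim: xs => [_|x xs IHxs hxs].
  split; first exact: EL_one.
  by have := hpsi _ _ (EL_one B n) (EL_one B n); rewrite mul1mx /close /=; lra.
have [ex hx] := EL_smallM hpsi (hxs x (or_introl erefl))
  (IHxs (fun y hy => hxs y (or_intror hy))).
split=> //; rewrite [size _]/= S_INR.
by rewrite /close in hx *; rewrite [mxprod _]/=; lra.
Qed.

Theorem theorem1p3 (A : comPzRingType) (n : nat) (hn : (6 <= n)%N)
  (h1 : forall g : 'M[A]_2, EL g <-> \det g = 1)
  (h2 : exists M : nat, forall g : 'M[A]_n, EL g ->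
          exists xs : seq 'M[A]_n,
            [/\ size xs = M,
                (forall x, List.In x xs ->
                   (exists s : 'M[A]_2, \det s = 1 /\ x = embed2 n s)
                   \/ EL_commutator x)
              & g = mxprod xs]) :
  forall psi : 'M[A]_n -> R, quasi_hom psi -> bounded_on_EL psi.
Proof.
move=> psi [D hD]; move: h2 => [M hM].
have hpsi : quasi_hom_defect D psi.
  move=> g h eg eh; apply/close_Rabs.
  by have := hD g h eg eh; congr (Rabs _ <= _)%re; lra.
have [C hC] : exists C, forall s : 'M[A]_2, \det s = 1 -> EL_small psi C (embed2 n s).
  case: n hn psi hpsi {hD hM} => [|[|[|m]]] // _ psi hpsi.
  exact: (@quasi_hom_embed2_bounded A m D psi h1 hpsi).
exists (D + INR M * (Rmax C (7 * D) + D))%re => g /hM[xs [<- hxs ->]].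
rewrite -[psi _]Rminus_0_r; apply/close_Rabs.
apply: (proj2 (mxprod_small hpsi _)) => x /hxs[[s [ds ->]]|cx].
  have [es hs] := hC s ds; split=> //.
  by have := Rmax_l C (7 * D); rewrite /close in hs *; lra.
have [ex hx] := commutator_small hpsi cx; split=> //.
by have := Rmax_r C (7 * D); rewrite /close in hx *; lra.
Qed.
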